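(* Let $n=p^t$, where $p$ is a prime and $t\geq 2$ is an integer. Then the Laplacian spectrum (as a multiset) of the zero divisor graph $\Gamma(\mathbb{Z}_n)$ is as follows. (i) If $t=2$: for $p=2$ it consists of the eigenvalue $0$ with multiplicity $1$; for $p\geq 3$ it consists of the eigenvalue $p-1$ with multiplicity $p-2$ and the eigenvalue $0$ with multiplicity $1$. (ii) If $t=2m$ for some integer $m\geq 2$: it consists of the eigenvalues $p^{2m-i}-1$ with multiplicity $\phi(p^i)$ for each $i\in\{1,\ldots,2m-1\}\setminus\{m\}$, the eigenvalue $p^m-1$ with multiplicity $\phi(p^m)-1$, and the eigenvalue $0$ with multiplicity $1$. (iii) If $t=2m+1$ for some integer $m\geq 1$: it consists of the eigenvalues $p^{2m+1-i}-1$ with multiplicity $\phi(p^i)$ for each $i\in\{1,\ldots,2m\}\setminus\{m+1\}$, the eigenvalue $p^m-1$ with multiplicity $\phi(p^{m+1})-1$, and the eigenvalue $0$ with multiplicity $1$.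
   Context: $\phi$ is Euler's totient function. The zero divisor graph $\Gamma(\mathbb{Z}_n)$ is the simple graph whose vertices are the nonzero zero divisors of $\mathbb{Z}_n$ (nonzero $x$ such that $xy=0$ for some nonzero $y$), two distinct vertices $x,y$ being adjacent iff $xy=0$ in $\mathbb{Z}_n$. For a finite simple graph $G$, the Laplacian matrix is $L(G)=D(G)-A(G)$ ($D(G)$ the diagonal matrix of vertex degrees, $A(G)$ the adjacency matrix), and the Laplacian spectrum of $G$ is the multiset of eigenvalues of $L(G)$. *)

(* Defs.v *)
From HB Require Import structures.
From mathcomp Require Import all_boot all_order all_algebra.
Set Implicit Arguments. Unset Strict Implicit. Unset Printing Implicit Defensive.
Import Order.TTheory GRing.Theory Num.Theory.
Local Open Scope ring_scope.

Record sgraph := SGraph {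
  vertex :> finType;
  adj : rel vertex;
  adj_sym : symmetric adj;
  adj_irrefl : irreflexive adj
}.

(* Rows and columns are indexed by the enumeration [enum_val] of the vertices;
   the characteristic polynomial does not depend on this choice. *)
Section LaplacianMatrix.
Variables (R : pzRingType) (G : sgraph).

Definition degree (x : G) : nat := #|[set y | adj x y]|.

Definition adjacency_mx : 'M[R]_#|G| :=
  \matrix_(i, j) (adj (enum_val i) (enum_val j))%:R.

Definition degree_mx : 'M[R]_#|G| :=
  diag_mx (\row_i (degree (enum_val i))%:R).

Definition laplacian_mx : 'M[R]_#|G| := degree_mx - adjacency_mx.

End LaplacianMatrix.

(* A multiset is represented by a sequence, to be compared with [perm_eq].
   The eigenvalues are the roots of the characteristic polynomial, repeated
   according to their multiplicity. *)
Definition spectrum (C : closedFieldType) (k : nat) (A : 'M[C]_k) : seq C :=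
  sval (closed_field_poly_normal (char_poly A)).

Definition laplacian_spectrum (C : closedFieldType) (G : sgraph) : seq C :=
  spectrum (laplacian_mx C G).

(* [closed_field_poly_normal] is opaque; this is all there is to know about
   its witness. *)
Lemma spectrumP (C : closedFieldType) (k : nat) (A : 'M[C]_k) :
  char_poly A = \prod_(a <- spectrum A) ('X - a%:P).
Proof.
rewrite /spectrum; case: closed_field_poly_normal => s /= {1}->.
by rewrite (monicP (char_poly_monic A)) scale1r.
Qed.

Section ZeroDivisorGraph.
Variable R : finComNzRingType.

Definition nonzero_zero_divisor (x : R) : bool :=
  (x != 0) && [exists y : R, (y != 0) && (x * y == 0)].

Definition zd_vertex : finType := {x : R | nonzero_zero_divisor x}.

Definition zd_adj (x y : zd_vertex) : bool :=
  (x != y) && (val x * val y == 0).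

Lemma zd_adj_sym : symmetric zd_adj.
Proof. by move=> x y; rewrite /zd_adj eq_sym mulrC. Qed.

Lemma zd_adj_irrefl : irreflexive zd_adj.
Proof. by move=> x; rewrite /zd_adj eqxx. Qed.

Definition zero_divisor_graph : sgraph := SGraph zd_adj_sym zd_adj_irrefl.

End ZeroDivisorGraph.

(* ['Z_n] is the ring of integers modulo n only for n >= 2. *)
Definition Gamma (n : nat) : sgraph := zero_divisor_graph 'Z_n.

(* Main.v *)
(* Gamma(Z_(p^t)) is a threshold graph: vertices x and y annihilate each other
   iff v(x) + v(y) >= t for the p-adic valuation v, so the vertices can be
   added one at a time, starting from the middle valuation, each new one being
   adjacent to all ("dominating") or to none of the previous ones. A new vertex
   x with c > 0 predecessors contributes the eigenvector equal to 1 on the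
   predecessors, -c at x and 0 elsewhere, with eigenvalue
   #{y | x y = 0} = p^v(x) - 1. These vectors and the all-ones vector, which
   has eigenvalue 0 and stands for the first vertex, are orthogonal. Exactly
   phi(p^i) vertices have valuation t - i. *)
Require Import Defs.
From HB Require Import structures.
From mathcomp Require Import all_boot all_order all_algebra.
From mathcomp Require Import zify ring.
Set Implicit Arguments. Unset Strict Implicit. Unset Printing Implicit Defensive.
Import Order.TTheory GRing.Theory Num.Theory.
Local Open Scope ring_scope.

(** * Spectra from an orthogonal eigenbasis *)

Lemma char_poly_diag (R : comNzRingType) (k : nat) (d : 'rV[R]_k) :
  char_poly (diag_mx d) = \prod_(i < k) ('X - (d 0 i)%:P).
Proof.
rewrite char_poly_trig ?diag_mx_is_trig //.
by apply: eq_bigr => i _; rewrite mxE eqxx.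
Qed.

(** The intertwining relation carries over to the characteristic matrices; taking determinants,
    [\det Q] is a nonzero constant polynomial and cancels. *)
Lemma char_poly_intertwine (F : fieldType) (k : nat) (P A B : 'M[F]_k) :
  P \in unitmx -> P *m A = B *m P -> char_poly A = char_poly B.
Proof.
move=> Pu PA; pose Q := map_mx polyC P.
have QA : Q *m char_poly_mx A = char_poly_mx B *m Q.
  rewrite /char_poly_mx mulmxBr mulmxBl -!map_mxM /= PA.
  by rewrite mul_mx_scalar mul_scalar_mx.
have Q0 : \det Q != 0 by rewrite det_map_mx polyC_eq0 -unitfE -unitmxE.
apply: (mulfI Q0); rewrite /char_poly -det_mulmx QA det_mulmx.
exact: mulrC.
Qed.

Lemma spectrum_perm (C : closedFieldType) (k : nat) (A : 'M[C]_k) (s : seq C) :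
  char_poly A = \prod_(a <- s) ('X - a%:P) -> perm_eq (spectrum A) s.
Proof. by move=> As; apply: prod_XsubC_eq; rewrite -spectrumP. Qed.

(** The first hypothesis is the eigenvector equation in coordinates. The pairing is bilinear,
    without conjugation, so isotropic vectors have to be excluded separately. Then [P *m P^T] is
    diagonal and invertible, hence [P] is invertible and conjugates the Laplacian to [diag_mx d]. *)
Lemma laplacian_spectrum_orthogonal_basis (C : closedFieldType) (G : sgraph)
    (f : G -> G -> C) (lam : G -> C) :
  (forall x y, \sum_z (adj z y)%:R * (f x y - f x z) = lam x * f x y) ->
  (forall x y, x != y -> \sum_z f x z * f y z = 0) ->
  (forall x, \sum_z f x z * f x z != 0) ->
  perm_eq (laplacian_spectrum C G) [seq lam x | x : G].
Proof.
move=> f_eigen f_orth f_norm; apply: spectrum_perm.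
pose P : 'M[C]_#|G| := \matrix_(i, j) f (enum_val i) (enum_val j).
pose d : 'rV[C]_#|G| := \row_i lam (enum_val i).
have PPT : P *m P^T
    = diag_mx (\row_i \sum_z f (enum_val i) z * f (enum_val i) z).
  apply/matrixP=> i j; rewrite !mxE.
  under eq_bigr do rewrite !mxE.
  rewrite -(big_enum_val (fun z => f (enum_val i) z * f (enum_val j) z)) /=.
  have [->|ij] := eqVneq i j; first by rewrite mulr1n.
  by rewrite mulr0n f_orth // (inj_eq enum_val_inj).
have Pu : P \in unitmx.
  have : P *m P^T \in unitmx.
    rewrite PPT unitmxE det_diag unitfE; apply/prodf_neq0 => i _.
    by rewrite mxE f_norm.
  by rewrite unitmx_mul => /andP[].
rewrite (char_poly_intertwine (B := diag_mx d) Pu) ?char_poly_diag.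
  rewrite big_image (big_enum_val (fun x => 'X - (lam x)%:P)) /=.
  by apply: eq_bigr => i _; rewrite mxE.
apply/matrixP=> i j; rewrite mul_diag_mx /laplacian_mx mulmxBr mul_mx_diag.
rewrite !mxE -f_eigen; set x := enum_val i; set y := enum_val j.
under eq_bigr do rewrite !mxE.
rewrite -(big_enum_val (fun z => f x z * (adj z y)%:R)) /=.
have -> : (degree y)%:R = \sum_z (adj z y)%:R :> C.
  rewrite /degree -sum1_card natr_sum big_mkcond /=.
  by apply: eq_bigr => z _; rewrite inE adj_sym; case: adj.
rewrite mulr_sumr -sumrB; apply: eq_bigr => z _; ring.
Qed.

(** * Threshold graphs, with vertices inserted in the order of [r] *)

Section ThresholdGraph.
Variables (C : numClosedFieldType) (G : sgraph) (r : G -> nat) (e : rel G).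
Variable dom : pred G.
Hypothesis r_inj : injective r.
Hypothesis adjE : forall x y, adj x y = (x != y) && e x y.
Hypothesis eE : forall x y, (r x <= r y)%N -> e x y = dom y.
Hypothesis eC : symmetric e.

Definition below (x : G) : nat := #|[pred y | (r y < r x)%N]|.

Definition threshold_vector (x y : G) : C :=
  if (r y < r x)%N then 1 else if below x == 0%N then 1
  else if y == x then - (below x)%:R else 0.

(** The count uses [e], which may hold on the diagonal: after the first vertex, the value is the
    degree plus one if [x] is dominating, and the degree otherwise. *)
Definition threshold_eigenvalue (x : G) : C :=
  if below x == 0%N then 0 else #|[pred y | e x y]|%:R.

Let u := threshold_vector.

Lemma sum_below (x : G) : \sum_z ((r z < r x)%N : nat)%:R = (below x)%:R :> C.
Proof.
rewrite /below -sum1_card natr_sum [RHS]big_mkcond /=.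
by apply: eq_bigr => z _; rewrite inE; case: ltnP.
Qed.

Lemma below0P (x y : G) : below x = 0%N -> (r x <= r y)%N.
Proof. by move=> /card0_eq/(_ y); rewrite !inE ltnNge => /negbFE. Qed.

Lemma threshold_vectorE (x y : G) : below x != 0%N ->
  u x y = (r y < r x)%:R - (below x)%:R * (y == x)%:R.
Proof.
rewrite /u /threshold_vector => /negPf->.
have [->|_] := eqVneq y x; first by rewrite ltnn mulr1 sub0r.
by rewrite mulr0 subr0; case: ifP.
Qed.

Lemma sum_pick (F : G -> C) (x : G) : \sum_z F z * (z == x)%:R = F x.
Proof.
rewrite (bigD1 x) //= eqxx mulr1 big1 ?addr0 // => z /negPf->.
by rewrite mulr0.
Qed.

Lemma sum_threshold_vector (x : G) : below x != 0%N -> \sum_z u x z = 0.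
Proof.
move=> bx; under eq_bigr do rewrite threshold_vectorE //.
by rewrite sumrB sum_below (sum_pick (fun=> _)) subrr.
Qed.

(** If [y] comes after [x], both sides vanish. Otherwise the summands of the two sides differ by a
    fixed multiple of [u x z], and these sum to 0 over [z]. *)
Lemma threshold_vector_eigen (x y : G) :
  \sum_z (adj z y)%:R * (u x y - u x z) = threshold_eigenvalue x * u x y.
Proof.
rewrite /threshold_eigenvalue.
have [b0|bx] := eqVneq (below x) 0%N.
  rewrite mul0r big1 // => z _; rewrite /u /threshold_vector b0 eqxx !if_same.
  by rewrite subrr mulr0.
(* The term [z = y] is zero, so the loops of [e] do not change the sum. *)
have -> : \sum_z (adj z y)%:R * (u x y - u x z)
        = \sum_z (e z y)%:R * (u x y - u x z).
  apply: eq_bigr => z _; rewrite adjE.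
  by have [->|_] := eqVneq; rewrite ?subrr ?mulr0.
have cardE : #|[pred z | e x z]|%:R = \sum_z (e x z)%:R :> C.
  rewrite -sum1_card natr_sum big_mkcond /=.
  by apply: eq_bigr => z _; rewrite inE; case: e.
rewrite cardE mulr_suml.
have eq_sum (F H : G -> C) :
    (forall z, F z - H z = - (dom x)%:R * u x z) -> \sum_z F z = \sum_z H z.
  move=> FH; apply/eqP; rewrite -subr_eq0 -sumrB; apply/eqP.
  under eq_bigr do rewrite FH.
  by rewrite -mulr_sumr sum_threshold_vector ?mulr0.
have [xy|yx|/r_inj xy] := ltngtP (r x) (r y).
- have uy : u x y = 0.
    rewrite threshold_vectorE // ltnNge ltnW //= -(inj_eq r_inj) gtn_eqF //=.
    by rewrite mulr0 subrr.
  rewrite uy [RHS]big1 => [|z _]; last by rewrite mulr0.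
  (* Up to [y], the factor [e z y] is [dom y]; beyond [y], the vector [u x] is zero. *)
  transitivity (\sum_z - (dom y)%:R * u x z).
    apply: eq_bigr => z _; rewrite sub0r mulrN mulNr; congr (- _).
    have [zy|yz] := leqP (r z) (r y); first by rewrite eE.
    have xz := ltn_trans xy yz.
    rewrite threshold_vectorE // ltnNge ltnW //= -(inj_eq r_inj) gtn_eqF //=.
    by rewrite mulr0 subrr !mulr0.
  by rewrite -mulr_sumr sum_threshold_vector // mulr0.
- have uy : u x y = 1 by rewrite /u /threshold_vector yx.
  rewrite uy; apply: eq_sum => z; rewrite mulr1.
  rewrite threshold_vectorE // -(inj_eq r_inj).
  have [zx|xz|zx] := ltngtP (r z) (r x); rewrite /= ?mulr1 ?mulr0.
  + by rewrite [e x z]eC (eE (ltnW zx)) subr0 subrr mulr0 sub0r mulr1.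
  + have yz := ltn_trans yx xz.
    by rewrite (eC z y) (eE (ltnW yz)) (eE (ltnW xz)) !subr0 mulr1 subrr mulr0.
  + rewrite (r_inj zx) (eC x y) (eE (ltnW yx)) (eE (leqnn (r x))).
    by move: (below x)%:R (dom x)%:R => b d; ring.
- rewrite -xy; have ux : u x x = - (below x)%:R.
    by rewrite threshold_vectorE // ltnn eqxx sub0r mulr1.
  rewrite ux; apply: eq_sum => z.
  rewrite threshold_vectorE // -(inj_eq r_inj).
  have [zx|xz|zx] := ltngtP (r z) (r x); rewrite /= ?mulr1 ?mulr0.
  + rewrite [e x z]eC (eE (ltnW zx)).
    by move: (below x)%:R (dom x)%:R => b d; ring.
  + by rewrite eC; move: (below x)%:R (e x z)%:R (dom x)%:R => b d d'; ring.
  + rewrite (r_inj zx) (eE (leqnn (r x))).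
    by move: (below x)%:R (dom x)%:R => b d; ring.
Qed.

(** For [x] before [y], the vector [u y] is 1 on all vertices up to [x]. These contain the support
    of [u x], unless [x] is first and [u x] is all ones. Either way the sum is the coordinate sum of
    a single vector, which is 0. *)
Lemma threshold_vector_orth (x y : G) :
  x != y -> \sum_z u x z * u y z = 0.
Proof.
wlog xy : x y / (r x < r y)%N => [th|] xDy.
  have [/th|yx|/r_inj/eqP] := ltngtP (r x) (r y); first exact.
    rewrite (eq_bigr _ (fun z _ => mulrC (u x z) (u y z))); apply: th => //.
    by rewrite eq_sym.
  by rewrite (negPf xDy).
have ltyE z : (r z <= r x)%N -> u y z = 1.
  by move=> zx; rewrite /u /threshold_vector (leq_ltn_trans zx).
have by0 : below y != 0%N.
  by apply/eqP => /(below0P x); rewrite leqNgt xy.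
have [bx|bx] := eqVneq (below x) 0%N.
  rewrite -[RHS](sum_threshold_vector by0); apply: eq_bigr => z _.
  by rewrite {1}/u /threshold_vector bx eqxx if_same mul1r.
rewrite -[RHS](sum_threshold_vector bx); apply: eq_bigr => z _.
have [/ltyE->|xz] := leqP (r z) (r x); first by rewrite mulr1.
rewrite threshold_vectorE // ltnNge ltnW //= -(inj_eq r_inj) gtn_eqF //.
by rewrite mulr0 subr0 mul0r.
Qed.

(** The coordinates are real, so this is a sum of nonnegative squares, positive at [z = x]. *)
Lemma threshold_vector_norm (x : G) : \sum_z u x z * u x z != 0.
Proof.
have u_real z : u x z \is Num.real.
  by rewrite /u /threshold_vector; do ?case: ifP => // _; rewrite ?realN ?realn.
have ux : u x x != 0.
  rewrite /u /threshold_vector ltnn eqxx; case: ifP => [_|/negbT bx].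
    exact: oner_neq0.
  by rewrite oppr_eq0 pnatr_eq0.
apply: lt0r_neq0; rewrite (bigD1 x) //= ltr_wpDr //.
  by apply: sumr_ge0 => z _; rewrite -expr2 real_exprn_even_ge0.
by rewrite -expr2 real_exprn_even_gt0 // ux orbT.
Qed.

Lemma laplacian_spectrum_threshold :
  perm_eq (laplacian_spectrum C G) [seq threshold_eigenvalue x | x : G].
Proof.
exact: laplacian_spectrum_orthogonal_basis threshold_vector_eigen
  threshold_vector_orth threshold_vector_norm.
Qed.

End ThresholdGraph.

(** * Multisets by multiplicities, and products in ['Z_n] *)

Lemma perm_flatten_nseq_count (T : eqType) (s u : seq T) :
  uniq u -> {subset s <= u} ->
  perm_eq (flatten [seq nseq (count_mem x s) x | x <- u]) s.
Proof.
move=> u_uniq su; apply/allP => y _ /=; apply/eqP.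
rewrite count_flatten -map_comp sumnE big_map.
under eq_bigr => x _ do rewrite /= count_nseq /=.
have [yu|yu] := boolP (y \in u).
  rewrite (bigD1_seq y) //= eqxx mul1n big1 ?addn0 // => x /negPf.
  by move->.
rewrite (count_memPn (contra (su y) yu)) big_seq big1 // => x xu.
by rewrite (negPf (_ : x != y)) //; apply: contraNneq yu => <-.
Qed.

Lemma Zp_mul_eq0 (n : nat) (x y : 'Z_n) :
  (1 < n)%N -> (x * y == 0) = (n %| x * y)%N.
Proof. by move=> n_gt1; rewrite -val_eqE /= [X in (_ %% X)%N]Zp_cast. Qed.

(** * The vertices for a prime power and their valuations *)

Section PrimePower.
Variables (p t : nat).
Hypotheses (p_prime : prime p) (t_ge2 : (2 <= t)%N).

Let p_gt0 : (0 < p)%N := prime_gt0 p_prime.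
Let p_gt1 : (1 < p)%N := prime_gt1 p_prime.

Let V : finType := Gamma (p ^ t).
Let w (x : V) : nat := val x.

Lemma prime_power_gt1 : (1 < p ^ t)%N.
Proof. by rewrite -(exp1n t) ltn_exp2r // (leq_trans _ t_ge2). Qed.

Lemma zero_divisor_prime_power (x : 'Z_(p ^ t)) :
  nonzero_zero_divisor x = (0 < x)%N && (p %| x)%N.
Proof.
rewrite /nonzero_zero_divisor -val_eqE /= -lt0n.
case: (posnP x) => //= x_gt0; apply/existsP/idP => [[y]|px].
  rewrite -val_eqE /= Zp_mul_eq0 ?prime_power_gt1 // -lt0n => /andP[y_gt0].
  (* If [p] does not divide [x], then [p ^ t] is coprime to [x] and must divide [y], which is too
     small. *)
  apply: contraLR => px; rewrite Gauss_dvdr; last first.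
    by rewrite coprimeXl // prime_coprime.
  rewrite gtnNdvd //; have := ltn_ord y.
  by rewrite [X in (_ < X)%N](Zp_cast prime_power_gt1).
(* The witness [p ^ t.-1] is nonzero modulo [p ^ t] and annihilates every multiple of [p]. *)
have lt_pt : (p ^ t.-1 < p ^ t)%N by rewrite ltn_exp2l // ltn_predL; lia.
have yE : ((p ^ t.-1)%:R : 'Z_(p ^ t)) = (p ^ t.-1)%N :> nat.
  by rewrite val_Zp_nat ?prime_power_gt1 // modn_small.
exists (p ^ t.-1)%:R; rewrite -val_eqE Zp_mul_eq0 ?prime_power_gt1 //.
rewrite [val _]yE [X in (_ * X)%N]yE -lt0n expn_gt0 p_gt0 /=.
by rewrite -{1}(ltn_predK t_ge2) expnS dvdn_mul.
Qed.

Lemma vertex_gt0 (x : V) : (0 < w x)%N.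
Proof. by have := valP x; rewrite zero_divisor_prime_power => /andP[]. Qed.

Lemma prime_dvd_vertex (x : V) : (p %| w x)%N.
Proof. by have := valP x; rewrite zero_divisor_prime_power => /andP[]. Qed.

Lemma vertex_lt (x : V) : (w x < p ^ t)%N.
Proof.
by have := ltn_ord (val x); rewrite [X in (_ < X)%N](Zp_cast prime_power_gt1).
Qed.

Lemma vertex_exists (a : nat) :
  (0 < a)%N -> (p %| a)%N -> (a < p ^ t)%N -> exists x : V, w x = a.
Proof.
move=> a_gt0 pa a_lt.
have aE : (a%:R : 'Z_(p ^ t)) = a :> nat.
  by rewrite val_Zp_nat ?prime_power_gt1 // modn_small.
have az : nonzero_zero_divisor (a%:R : 'Z_(p ^ t)).
  by rewrite zero_divisor_prime_power aE a_gt0.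
by exists (exist _ a%:R az).
Qed.

(** Since [a] is positive, every multiple of [p ^ a] strictly between 0 and [p ^ t] is a vertex. *)
Lemma card_vertex_dvd (a : nat) : (0 < a <= t)%N ->
  #|[pred x : V | (p ^ a %| w x)%N]| = (p ^ (t - a) - 1)%N.
Proof.
move=> /andP[a_gt0 a_le].
have pdv b : (p ^ a %| b)%N -> (p %| b)%N.
  by apply: dvdn_trans; rewrite -{1}(expn1 p) dvdn_exp2l.
transitivity (\sum_(1 <= b < p ^ t) (p ^ a %| b)%N)%N; last first.
  (* The added 1 stands for the multiple [b = p ^ t], which completes the range of
     [divn_count_dvd]. *)
  apply/eqP; rewrite -(eqn_add2r 1) subnK ?expn_gt0 ?p_gt0 //.
  have := divn_count_dvd (p ^ a) (p ^ t).
  rewrite big_nat_recr ?expn_gt0 ?p_gt0 //= dvdn_exp2l // => <-.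
  by rewrite expnB.
transitivity (\sum_(x : V) (p ^ a %| val (val x)))%N.
  rewrite -sum1_card big_mkcond /=.
  by apply: eq_bigr => x _; rewrite inE /w /=; case: dvdn.
rewrite -(big_sub (fun x : 'Z_(p ^ t) => nonzero_zero_divisor x)
   (fun x : 'Z_(p ^ t) => (p ^ a %| x)%N : nat)) /=.
rewrite big_geq_mkord -[in RHS](Zp_cast prime_power_gt1) big_mkcond.
rewrite [RHS]big_mkcond.
apply: eq_bigr => x _ /=.
rewrite unfold_in zero_divisor_prime_power; case: posnP => //= _.
by case: ifP => // /negbT px; apply/esym/eqP; rewrite eqb0 (contra (@pdv _) px).
Qed.

(** This is the index [i] of the theorem: [p ^ coval x] is the additive order of [x] modulo
    [p ^ t]. *)
Definition coval (x : V) : nat := (t - logn p (w x))%N.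

Lemma logn_vertex (x : V) : (0 < logn p (w x) < t)%N.
Proof.
rewrite -pfactor_dvdn ?vertex_gt0 // expn1 prime_dvd_vertex /= ltnNge.
rewrite -pfactor_dvdn ?vertex_gt0 //.
by rewrite gtnNdvd ?vertex_gt0 ?vertex_lt.
Qed.

Lemma vertex_mul_eq0 (x y : V) :
  (val x * val y == 0) = (t <= logn p (w x) + logn p (w y))%N.
Proof.
rewrite Zp_mul_eq0 ?prime_power_gt1 // pfactor_dvdn //.
  by rewrite lognM ?vertex_gt0.
by rewrite muln_gt0 !vertex_gt0.
Qed.

(** The annihilators of [x] are the multiples of [p ^ (t - v(x))]; [x] itself is counted when its
    square is 0. *)
Lemma card_vertex_annihilator (x : V) :
  #|[pred y : V | val x * val y == 0]| = (p ^ logn p (w x) - 1)%N.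
Proof.
have /andP[v0 vt] := logn_vertex x.
rewrite -{1}(subKn (ltnW vt)) -card_vertex_dvd; last by lia.
apply: eq_card => y; rewrite !inE vertex_mul_eq0.
by rewrite pfactor_dvdn ?vertex_gt0 // leq_subLR.
Qed.

(** Valuation exactly [t - i] means divisibility by [p ^ (t - i)] but not by the next power, so the
    count is [(p ^ i - 1) - (p ^ i.-1 - 1)]. *)
Lemma card_coval (i : nat) : (0 < i < t)%N ->
  #|[pred x : V | coval x == i]| = totient (p ^ i).
Proof.
move=> /andP[i0 it]; rewrite totient_pfactor //.
have c1 : #|[pred x : V | (p ^ (t - i) %| w x)%N]| = (p ^ i - 1)%N.
  by rewrite card_vertex_dvd ?(subKn (ltnW it)) //; lia.
have c2 : #|[pred x : V | (p ^ (t - i).+1 %| w x)%N]| = (p ^ i.-1 - 1)%N.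
  by rewrite card_vertex_dvd; [congr (p ^ _ - 1)%N|]; lia.
have := cardID [pred x : V | (p ^ (t - i).+1 %| w x)%N]
               [pred x : V | (p ^ (t - i) %| w x)%N].
rewrite c1.
rewrite (eq_card (B := [pred x : V | (p ^ (t - i).+1 %| w x)%N])); last first.
  move=> x; rewrite !inE andb_idl // => h.
  by apply: dvdn_trans h; apply: dvdn_exp2l.
rewrite c2.
rewrite (eq_card (B := [pred x : V | coval x == i])); last first.
  move=> x; rewrite !inE !pfactor_dvdn ?vertex_gt0 // /coval.
  by have := logn_vertex x; lia.
have piE : (p ^ i = p * p ^ i.-1)%N by rewrite -expnS prednK.
have pi_gt0 : (0 < p ^ i.-1)%N by rewrite expn_gt0 p_gt0.
rewrite piE -(subn1 p) mulnBl mul1n {c1 c2 piE}.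
have := leq_pmull (p ^ i.-1) p_gt0.
by move: (p ^ _)%N (p * _)%N #|_| pi_gt0; lia.
Qed.

Lemma perm_coval :
  perm_eq (flatten [seq nseq (totient (p ^ i)) i | i <- index_iota 1 t])
          [seq coval x | x : V].
Proof.
have <- : [seq nseq (count_mem i [seq coval x | x : V]) i
             | i <- index_iota 1 t]
        = [seq nseq (totient (p ^ i)) i | i <- index_iota 1 t].
  apply/eq_in_map => i; rewrite mem_index_iota => /card_coval <-.
  by rewrite count_map -sum1_count big_enum_cond -sum1_card.
apply: perm_flatten_nseq_count; first exact: iota_uniq.
move=> _ /imageP[x _ ->]; rewrite mem_index_iota /coval.
by have := logn_vertex x; lia.
Qed.

(** * The insertion order *)

(* When the vertices are added by increasing [rank], valuations come in the
   order m, m - 1, m + 1, m - 2, ... if t = 2m, and m, m + 1, m - 1, m + 2, ...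
   if t = 2m + 1; then each new vertex annihilates all or none of the previous
   ones. *)
Definition dominating (x : V) : bool := (t <= 2 * logn p (w x))%N.

Definition rank_class (x : V) : nat :=
  if dominating x then (2 * logn p (w x) - t).+1 else (t - 2 * logn p (w x))%N.

(** The order is lexicographic: [w x < p ^ t] breaks ties inside a class and makes the rank
    injective. *)
Definition rank (x : V) : nat := (rank_class x * p ^ t + w x)%N.

Lemma rank_inj : injective rank.
Proof.
move=> x y /(congr1 (modn^~ (p ^ t)%N)).
rewrite /rank !modnMDl !modn_small ?vertex_lt // => wxy.
by apply/val_inj/val_inj.
Qed.

Lemma rank_class_homo (x y : V) :
  (rank x <= rank y)%N -> (rank_class x <= rank_class y)%N.
Proof.
rewrite /rank leqNgt => xy; rewrite leqNgt; apply: contra xy => xy.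
have := vertex_lt y; have := leq_mul2r (p ^ t) (rank_class y).+1 (rank_class x).
rewrite xy orbT mulSn => h1 h2; lia.
Qed.

(** The class is the distance from [2 v(x)] to [t], plus one on the dominating side. On opposite
    sides, comparing classes compares [2 (v(x) + v(y))] with the odd number [2 t - 1], which decides
    whether the sum of valuations reaches [t]. *)
Lemma vertex_mul_eq0_rank (x y : V) :
  (rank x <= rank y)%N -> (val x * val y == 0) = dominating y.
Proof.
move/rank_class_homo; rewrite vertex_mul_eq0 /rank_class /dominating.
have := logn_vertex x; have := logn_vertex y.
by do 2 case: ifP; lia.
Qed.

Lemma rank_class_gt0 (x : V) : (0 < rank_class x)%N.
Proof. by rewrite /rank_class /dominating; case: ifP; lia. Qed.

Lemma rank_class_le1 (x : V) :
  (rank_class x <= 1)%N = (logn p (w x) == t./2).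
Proof. by rewrite /rank_class /dominating; case: ifP; lia. Qed.

(** The first class consists of the vertices of valuation [t./2], and its least element is
    [p ^ t./2]. *)
Lemma rank_min : exists2 x0 : V, coval x0 = uphalf t &
  forall y, (rank x0 <= rank y)%N.
Proof.
have th : (0 < t./2 < t)%N by lia.
case/andP: th => th0 tht.
have [||| x0 wx0] := @vertex_exists (p ^ t./2)%N.
- by rewrite expn_gt0 p_gt0.
- by rewrite dvdn_exp.
- by rewrite ltn_exp2l.
have vx0 : logn p (w x0) = t./2 by rewrite wx0 pfactorK.
exists x0 => [|y]; first by rewrite /coval vx0; lia.
have cx0 : (rank_class x0 <= 1)%N by rewrite rank_class_le1 vx0.
have [yx|] := leqP (rank_class y) (rank_class x0); last first.
  move=> xy; rewrite leqNgt; apply/negP => /ltnW/rank_class_homo.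
  by rewrite leqNgt xy.
have cy := leq_trans yx cx0.
have -> : rank x0 = (rank_class y * p ^ t + w x0)%N.
  by rewrite /rank; congr (_ * _ + _)%N; have := rank_class_gt0 y; lia.
rewrite /rank leq_add2l wx0 dvdn_leq ?vertex_gt0 //.
by move: cy; rewrite rank_class_le1 pfactor_dvdn ?vertex_gt0 // => /eqP->.
Qed.

(** Both parities are treated at once: [uphalf t] is [m] for [t = 2m] and [m + 1] for [t = 2m + 1].
    The first vertex lies in this class and has eigenvalue 0, hence the multiplicity lowered by
    one. *)
Lemma laplacian_spectrum_Gamma_prime_power (C : numClosedFieldType) :
  perm_eq (laplacian_spectrum C (Gamma (p ^ t)))
    (flatten [seq nseq (totient (p ^ i)) (p%:R ^+ (t - i) - 1)
             | i <- index_iota 1 t & i != uphalf t]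
     ++ nseq (totient (p ^ uphalf t) - 1) (p%:R ^+ (t - uphalf t) - 1)
     ++ [:: 0]).
Proof.
have [x0 ix0 x0_min] := rank_min.
have below_x0 : below (G := Gamma (p ^ t)) rank x0 = 0%N.
  by apply: eq_card0 => y; rewrite !inE ltnNge x0_min.
pose g (i : nat) : C := p%:R ^+ (t - i) - 1.
have lamE (x : V) : x != x0 ->
  threshold_eigenvalue C (G := Gamma (p ^ t)) rank
    (fun x y => val x * val y == 0) x = g (coval x).
  move=> xx0; rewrite /threshold_eigenvalue ifN.
    rewrite card_vertex_annihilator natrB ?expn_gt0 ?p_gt0 // natrX /g subKn //.
    by have := logn_vertex x; lia.
  (* By injectivity of the rank, only [x0] has no predecessor. *)
  apply: contra xx0 => /eqP/(below0P x0) le_x; apply/eqP/rank_inj/eqP.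
  by rewrite eqn_leq x0_min le_x.
have /perm_trans -> // := @laplacian_spectrum_threshold C (Gamma (p ^ t)) rank
  (fun x y => val x * val y == 0) dominating rank_inj
  (fun x y => erefl) vertex_mul_eq0_rank
  (fun x y => congr1 (eq_op^~ 0) (mulrC _ _)).
have enumE := perm_to_rem (mem_enum V x0 : x0 \in enum V).
have restE : perm_eq [seq coval x | x <- rem x0 (enum V)]
    (flatten [seq nseq (totient (p ^ i)) i
             | i <- index_iota 1 t & i != uphalf t]
     ++ nseq (totient (p ^ uphalf t) - 1) (uphalf t)).
  have iota0 : uphalf t \in index_iota 1 t by rewrite mem_index_iota; lia.
  rewrite -(perm_cons (uphalf t)) -{1}ix0 -(map_cons coval).
  rewrite -(permPl (perm_map coval enumE)) -(permPl perm_coval).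
  rewrite (permPl (perm_flatten (perm_map _ (perm_to_rem iota0)))).
  rewrite rem_filter ?iota_uniq // [map _ (_ :: _)]/= [flatten _]/=.
  (* The totient is positive, so one copy of [uphalf t] can be split off to match [x0]. *)
  have phiS : totient (p ^ uphalf t) = (totient (p ^ uphalf t) - 1).+1.
    by rewrite subn1 prednK // totient_gt0 expn_gt0 p_gt0.
  by rewrite {1}phiS /= perm_cons perm_catC.
rewrite (permPl (perm_map _ enumE)) map_cons.
rewrite {1}/threshold_eigenvalue below_x0 eqxx catA cats1 perm_sym.
rewrite perm_rcons perm_cons perm_sym.
have -> : [seq threshold_eigenvalue C (G := Gamma (p ^ t)) rank
    (fun x y => val x * val y == 0) x | x <- rem x0 (enum V)]
  = [seq g i | i <- [seq coval x | x <- rem x0 (enum V)]].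
  rewrite -map_comp; apply/eq_in_map => x.
  by rewrite mem_rem_uniq ?enum_uniq // inE => /andP[/lamE].
rewrite (permPl (perm_map g restE)) map_cat map_flatten -map_comp map_nseq.
by rewrite (eq_map (g := fun i => nseq (totient (p ^ i)) (g i))) // => i /=;
   rewrite map_nseq.
Qed.

End PrimePower.

Theorem theorem4p3 (C : numClosedFieldType) (n p t : nat)
    (p_prime : prime p) (t_ge2 : (2 <= t)%N) (n_def : n = (p ^ t)%N) :
  [/\ t = 2%N ->
        (p = 2%N -> perm_eq (laplacian_spectrum C (Gamma n)) [:: 0]) /\
        ((3 <= p)%N ->
           perm_eq (laplacian_spectrum C (Gamma n))
             (nseq (p - 2) (p%:R - 1) ++ [:: 0])),
      forall m : nat, (2 <= m)%N -> t = (2 * m)%N ->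
        perm_eq (laplacian_spectrum C (Gamma n))
          (flatten [seq nseq (totient (p ^ i)) (p%:R ^+ (2 * m - i) - 1)
                   | i <- index_iota 1 (2 * m) & i != m]
           ++ nseq (totient (p ^ m) - 1) (p%:R ^+ m - 1)
           ++ [:: 0])
    & forall m : nat, (1 <= m)%N -> t = (2 * m + 1)%N ->
        perm_eq (laplacian_spectrum C (Gamma n))
          (flatten [seq nseq (totient (p ^ i)) (p%:R ^+ (2 * m + 1 - i) - 1)
                   | i <- index_iota 1 (2 * m + 1) & i != (m + 1)%N]
           ++ nseq (totient (p ^ (m + 1)) - 1) (p%:R ^+ m - 1)
           ++ [:: 0])].
Proof.
subst n; have spec := laplacian_spectrum_Gamma_prime_power p_prime t_ge2 C.
split=> [t2|m m_ge2 tm|m m_ge1 tm]; move: spec.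
(* Here [uphalf t = 1] is the only index, so the flattened part is empty and
   [totient p - 1 = p - 2], which is 0 for [p = 2]. *)
- rewrite t2 /= expn1 totient_prime // expr1 -subn1 -subnDA => spec.
  split=> [p2|_]; last exact: spec.
  by rewrite p2 in spec *; apply: spec.
- have -> : uphalf t = m by lia.
  have -> : (t - m = m)%N by lia.
  by rewrite tm.
- have -> : uphalf t = (m + 1)%N by lia.
  have -> : (t - (m + 1) = m)%N by lia.
  by rewrite tm.
Qed.
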